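(* Let $a_x>a_y>a_z>0$ be real numbers and let $P_G=(X_G,Y_G,Z_G)$ be a point of $\mathbb{R}^3$ with $X_G,Y_G\ge 0$ and $Z_G>0$. Put $P=a_x^2-a_z^2$, $Q=a_y^2-a_z^2$, and let $B(z)=B_6z^6+B_5z^5+B_4z^4+B_3z^3+B_2z^2+B_1z+B_0$, where $$\begin{aligned} B_6&=P^2Q^2,\\ B_5&=2a_z^2Z_G\,PQ(P+Q),\\ B_4&=a_z^2\left(a_x^2Q^2X_G^2+a_y^2P^2Y_G^2+a_z^2(P^2+Q^2+4PQ)Z_G^2-P^2Q^2\right),\\ B_3&=2a_z^4Z_G\left(a_x^2QX_G^2+a_y^2PY_G^2+a_z^2(P+Q)Z_G^2-PQ(P+Q)\right),\\ B_2&=a_z^6Z_G^2\left(a_x^2X_G^2+a_y^2Y_G^2+a_z^2Z_G^2-P^2-Q^2-4PQ\right),\\ B_1&=-2a_z^8Z_G^3(P+Q),\\ B_0&=-a_z^{10}Z_G^4. \end{aligned}$$ Then $B(z)$ has only one real positive root, and this root is equal to $Z_E$, the third coordinate of the footpoint $P_E=(X_E,Y_E,Z_E)$ of $P_G$. Moreover, the other coordinates of the footpoint are $$X_E=\frac{a_x^2X_GZ_E}{PZ_E+a_z^2Z_G},\qquad Y_E=\frac{a_y^2Y_GZ_E}{QZ_E+a_z^2Z_G}.$$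
   Context: The reference ellipsoid is $\frac{X^2}{a_x^2}+\frac{Y^2}{a_y^2}+\frac{Z^2}{a_z^2}=1$. The footpoint of $P_G$ is the intersection point with the ellipsoid of the ellipsoidal normal passing through $P_G$. For $P_G$ in the first octant with $Z_G>0$, this means the point $P_E=(X_E,Y_E,Z_E)$ of the ellipsoid with $X_E,Y_E,Z_E\ge0$ for which $P_G-P_E$ is a real multiple of the normal vector $\left(\frac{X_E}{a_x^2},\frac{Y_E}{a_y^2},\frac{Z_E}{a_z^2}\right)$ to the ellipsoid at $P_E$, that is, $P_G-P_E=t\left(\frac{X_E}{a_x^2},\frac{Y_E}{a_y^2},\frac{Z_E}{a_z^2}\right)$ for some $t\in\mathbb{R}$. *)

(* Defs.v *)
From HB Require Import structures.
From mathcomp Require Import all_boot all_order all_algebra.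
From mathcomp Require Import reals.

Set Implicit Arguments.
Unset Strict Implicit.
Unset Printing Implicit Defensive.

Import Order.TTheory GRing.Theory Num.Theory.
Local Open Scope ring_scope.

(* The numerals 0, 1, 2 below are column indices in 'I_3. *)
Definition xcoord (R : realType) (p : 'rV[R]_3) : R := p 0 0.
Definition ycoord (R : realType) (p : 'rV[R]_3) : R := p 0 1.
Definition zcoord (R : realType) (p : 'rV[R]_3) : R := p 0 2.

Definition row3 (R : realType) (x y z : R) : 'rV[R]_3 :=
  \row_j [:: x; y; z]`_j.

Definition on_ellipsoid (R : realType) (ax ay az : R) (p : 'rV[R]_3) : Prop :=
  xcoord p ^+ 2 / ax ^+ 2 + ycoord p ^+ 2 / ay ^+ 2
    + zcoord p ^+ 2 / az ^+ 2 = 1.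

Definition ellipsoid_normal (R : realType) (ax ay az : R) (p : 'rV[R]_3) :
    'rV[R]_3 :=
  row3 (xcoord p / ax ^+ 2) (ycoord p / ay ^+ 2) (zcoord p / az ^+ 2).

(* The sign conditions select the relevant intersection of the normal line   *)
(* with the ellipsoid; they are meant for PG in the first octant with        *)
(* 0 < zcoord PG.                                                            *)
Definition is_footpoint (R : realType) (ax ay az : R) (PG PE : 'rV[R]_3) :
    Prop :=
  [/\ on_ellipsoid ax ay az PE,
      [/\ 0 <= xcoord PE, 0 <= ycoord PE & 0 <= zcoord PE]
    & exists t : R, PG - PE = t *: ellipsoid_normal ax ay az PE].

Definition polyB (R : realType) (ax ay az : R) (PG : 'rV[R]_3) : {poly R} :=
  let XG := xcoord PG in
  let YG := ycoord PG in
  let ZG := zcoord PG in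
  let P := ax ^+ 2 - az ^+ 2 in
  let Q := ay ^+ 2 - az ^+ 2 in
  let B6 := P ^+ 2 * Q ^+ 2 in
  let B5 := 2 * az ^+ 2 * ZG * P * Q * (P + Q) in
  let B4 := az ^+ 2 *
    (ax ^+ 2 * Q ^+ 2 * XG ^+ 2 + ay ^+ 2 * P ^+ 2 * YG ^+ 2
     + az ^+ 2 * (P ^+ 2 + Q ^+ 2 + 4 * P * Q) * ZG ^+ 2
     - P ^+ 2 * Q ^+ 2) in
  let B3 := 2 * az ^+ 4 * ZG *
    (ax ^+ 2 * Q * XG ^+ 2 + ay ^+ 2 * P * YG ^+ 2
     + az ^+ 2 * (P + Q) * ZG ^+ 2 - P * Q * (P + Q)) in
  let B2 := az ^+ 6 * ZG ^+ 2 *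
    (ax ^+ 2 * XG ^+ 2 + ay ^+ 2 * YG ^+ 2 + az ^+ 2 * ZG ^+ 2
     - P ^+ 2 - Q ^+ 2 - 4 * P * Q) in
  let B1 := - 2 * az ^+ 8 * ZG ^+ 3 * (P + Q) in
  let B0 := - az ^+ 10 * ZG ^+ 4 in
  B6 *: 'X^6 + B5 *: 'X^5 + B4 *: 'X^4 + B3 *: 'X^3 + B2 *: 'X^2
    + B1 *: 'X + B0%:P.

(* Main.v *)
Require Import Defs.
From mathcomp Require Import all_boot all_order all_algebra.
From mathcomp Require Import reals.
From mathcomp Require Import ring lra.

Import Order.TTheory GRing.Theory Num.Theory.
Local Open Scope ring_scope.

(** Write [P = ax^2 - az^2], [Q = ay^2 - az^2] and [c = az^2 * ZG].
    Eliminating the multiplier [t] from [PG - PE = t *: normal] between the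
    third coordinate and each of the other two expresses the whole footpoint
    through its height [z]: [X = ax^2 XG z / (P z + c)] and
    [Y = ay^2 YG z / (Q z + c)] ([normal_line_coordP]).  Substituting these into
    the equation of the ellipsoid leaves one equation [height_eq z = 1], with

      [height_eq z = ax^2 XG^2 (z / (P z + c))^2
                     + ay^2 YG^2 (z / (Q z + c))^2 + z^2 / az^2],

    and [B] is what becomes of [height_eq z - 1] once multiplied by
    [az^2 (P z + c)^2 (Q z + c)^2] ([polyB_height_eq]).  For [z > 0] this
    factor is positive, so the positive roots of [B] are exactly the heights of
    the footpoints ([root_polyBP], [footpointP]).

    Each [z / (P z + c)] is nondecreasing and [z^2] is increasing, so
    [height_eq] takes the value 1 at most once on the positive reals
    ([height_eq_inj]); and [B.[0] < 0 <= B.[az]], so the value is attained by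
    the intermediate value theorem ([polyB_pos_root]). *)

(** * Coordinates *)

Lemma row3_coords {R : realType} (x y z : R) :
  [/\ xcoord (row3 x y z) = x, ycoord (row3 x y z) = y
    & zcoord (row3 x y z) = z].
Proof. by rewrite /xcoord /ycoord /zcoord /row3 !mxE. Qed.

Lemma coords_inj {R : realType} {p q : 'rV[R]_3} :
  xcoord p = xcoord q -> ycoord p = ycoord q -> zcoord p = zcoord q -> p = q.
Proof.
move=> hx hy hz; apply/rowP => -[[|[|[|//]]] hi].
- by move: hx; rewrite /xcoord; congr (p _ _ = q _ _); apply: val_inj.
- by move: hy; rewrite /ycoord; congr (p _ _ = q _ _); apply: val_inj.
- by move: hz; rewrite /zcoord; congr (p _ _ = q _ _); apply: val_inj.
Qed.

Lemma normal_line_coords {R : realType} (ax ay az t : R) (PG PE : 'rV[R]_3) :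
  PG - PE = t *: ellipsoid_normal ax ay az PE <->
  [/\ xcoord PG - xcoord PE = t * (xcoord PE / ax ^+ 2),
      ycoord PG - ycoord PE = t * (ycoord PE / ay ^+ 2)
    & zcoord PG - zcoord PE = t * (zcoord PE / az ^+ 2)].
Proof.
have coordB (p q : 'rV[R]_3) : [/\ xcoord (p - q) = xcoord p - xcoord q,
    ycoord (p - q) = ycoord p - ycoord q & zcoord (p - q) = zcoord p - zcoord q].
  by rewrite /xcoord /ycoord /zcoord !mxE.
have coordZ (p : 'rV[R]_3) : [/\ xcoord (t *: p) = t * xcoord p,
    ycoord (t *: p) = t * ycoord p & zcoord (t *: p) = t * zcoord p].
  by rewrite /xcoord /ycoord /zcoord !mxE.
have [Bx By Bz] := coordB PG PE.
have [Zx Zy Zz] := coordZ (ellipsoid_normal ax ay az PE).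
have [Nx Ny Nz] := row3_coords (xcoord PE / ax ^+ 2) (ycoord PE / ay ^+ 2)
  (zcoord PE / az ^+ 2).
rewrite -/(ellipsoid_normal ax ay az PE) in Nx Ny Nz.
split=> [e | [ex ey ez]].
  by rewrite -Bx -By -Bz -Nx -Ny -Nz -Zx -Zy -Zz e.
by apply: coords_inj; rewrite (Bx, By, Bz) (Zx, Zy, Zz) (Nx, Ny, Nz).
Qed.

(** * The normal line through the given point *)

(** A third coordinate [z > 0] forces [t = az^2 (ZG - z) / z]; with this value
    the equation for a coordinate [x] along a semi-axis [a] becomes linear
    in [x]. *)
Lemma normal_line_coordP {R : realType} {a az XG ZG x z t : R} :
  0 < az -> az < a -> 0 < ZG -> 0 < z -> ZG - z = t * (z / az ^+ 2) ->
  (XG - x = t * (x / a ^+ 2) <->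
   x = a ^+ 2 * XG * z / ((a ^+ 2 - az ^+ 2) * z + az ^+ 2 * ZG)).
Proof.
move=> az0 aza ZG0 z0 ez.
have et : t = az ^+ 2 * (ZG - z) / z.
  by rewrite ez; field; rewrite !lt0r_neq0.
have D0 : 0 < (a ^+ 2 - az ^+ 2) * z + az ^+ 2 * ZG.
  by apply: addr_gt0; apply: mulr_gt0; rewrite ?exprn_gt0 //; nra.
have a0 : 0 < a by apply: lt_trans aza.
have key : (XG - x - t * (x / a ^+ 2)) * (a ^+ 2 * z) =
    a ^+ 2 * XG * z - x * ((a ^+ 2 - az ^+ 2) * z + az ^+ 2 * ZG).
  by rewrite et; field; rewrite !lt0r_neq0.
have c0 : a ^+ 2 * z != 0 by rewrite lt0r_neq0 // mulr_gt0 // exprn_gt0.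
split=> [ex | ex].
  move: key; rewrite ex subrr mul0r => /esym/subr0_eq ->.
  by rewrite mulfK // lt0r_neq0.
apply: subr0_eq; apply: (mulIf c0); rewrite key mul0r ex divfK ?subrr //.
by rewrite lt0r_neq0.
Qed.

(** * The equation for the height of the footpoint *)

Definition height_eq {R : realType} (ax ay az : R) (PG : 'rV[R]_3) (z : R) : R :=
  let c := az ^+ 2 * zcoord PG in
  ax ^+ 2 * xcoord PG ^+ 2 * (z / ((ax ^+ 2 - az ^+ 2) * z + c)) ^+ 2
  + ay ^+ 2 * ycoord PG ^+ 2 * (z / ((ay ^+ 2 - az ^+ 2) * z + c)) ^+ 2
  + z ^+ 2 / az ^+ 2.

Lemma homographic_le {R : realType} {p c y z : R} :
  0 < p -> 0 < c -> 0 < y -> y <= z -> y / (p * y + c) <= z / (p * z + c).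
Proof.
move=> p0 c0 y0 yz.
have z0 : 0 < z by apply: lt_le_trans yz.
have Dy : 0 < p * y + c by rewrite addr_gt0 // mulr_gt0.
have Dz : 0 < p * z + c by rewrite addr_gt0 // mulr_gt0.
rewrite ler_pdivrMr // mulrAC ler_pdivlMr //; nra.
Qed.

Section Height.
Context {R : realType} {ax ay az : R} {PG : 'rV[R]_3}.
Hypotheses (az_gt0 : 0 < az) (az_lt_ay : az < ay) (ay_lt_ax : ay < ax).
Hypotheses (XG_ge0 : 0 <= xcoord PG) (YG_ge0 : 0 <= ycoord PG).
Hypothesis ZG_gt0 : 0 < zcoord PG.

Let P := ax ^+ 2 - az ^+ 2.
Let Q := ay ^+ 2 - az ^+ 2.
Let c := az ^+ 2 * zcoord PG.
Let B := polyB ax ay az PG.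

Let ay_gt0 : 0 < ay. Proof. exact: lt_trans az_lt_ay. Qed.
Let ax_gt0 : 0 < ax. Proof. exact: lt_trans ay_lt_ax. Qed.
Let az_lt_ax : az < ax. Proof. exact: lt_trans ay_lt_ax. Qed.
Let P_gt0 : 0 < P. Proof. by rewrite /P; move: az_gt0 az_lt_ax; nra. Qed.
Let Q_gt0 : 0 < Q. Proof. by rewrite /Q; move: az_gt0 az_lt_ay; nra. Qed.
Let c_gt0 : 0 < c. Proof. by rewrite /c mulr_gt0 // exprn_gt0. Qed.
Let den_gt0 (p z : R) : 0 < p -> 0 < z -> 0 < p * z + c.
Proof. by move=> p0 z0; rewrite addr_gt0 // mulr_gt0. Qed.

Lemma height_eq_lt {y z : R} : 0 < y -> y < z ->
  height_eq ax ay az PG y < height_eq ax ay az PG z.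
Proof.
move=> y0 yz; have z0 : 0 < z by apply: lt_trans yz.
have sq_homographic_le (p : R) : 0 < p ->
    (y / (p * y + c)) ^+ 2 <= (z / (p * z + c)) ^+ 2.
  move=> p0; apply: lerXn2r; rewrite ?nnegrE; last exact/homographic_le/ltW.
  - by rewrite divr_ge0 // ltW // den_gt0.
  - by rewrite divr_ge0 // ltW // den_gt0.
rewrite /height_eq -/c -/P -/Q; apply: ler_ltD.
  by apply: lerD; apply: ler_wpM2l;
     rewrite ?(mulr_ge0 (sqr_ge0 _) (sqr_ge0 _)) //; apply: sq_homographic_le.
by rewrite ltr_pM2r ?invr_gt0 ?exprn_gt0 // ltrXn2r // ltW.
Qed.

Lemma height_eq_inj {y z : R} : 0 < y -> 0 < z ->
  height_eq ax ay az PG y = height_eq ax ay az PG z -> y = z.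
Proof.
move=> y0 z0 e; case: (ltgtP y z) => // lt_yz.
- by have := height_eq_lt y0 lt_yz; rewrite e ltxx.
- by have := height_eq_lt z0 lt_yz; rewrite e ltxx.
Qed.

(** * The sextic polynomial *)

Lemma horner_polyB (z : R) : B.[z] =
  az ^+ 2 * (ax ^+ 2 * xcoord PG ^+ 2 * z ^+ 2 * (Q * z + c) ^+ 2
             + ay ^+ 2 * ycoord PG ^+ 2 * z ^+ 2 * (P * z + c) ^+ 2)
  + (z ^+ 2 - az ^+ 2) * (P * z + c) ^+ 2 * (Q * z + c) ^+ 2.
Proof. by rewrite /B /polyB !(hornerD, hornerZ, hornerXn, hornerX, hornerC) /P /Q /c; ring. Qed.

Lemma polyB_height_eq {z : R} : 0 < z -> B.[z] =
  az ^+ 2 * (P * z + c) ^+ 2 * (Q * z + c) ^+ 2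
  * (height_eq ax ay az PG z - 1).
Proof.
move=> z0; rewrite horner_polyB /height_eq -/c -/P -/Q.
have DP : P * z + c != 0 by rewrite lt0r_neq0 // den_gt0.
have DQ : Q * z + c != 0 by rewrite lt0r_neq0 // den_gt0.
by move: c P Q DP DQ => c' P' Q' DP DQ; field; rewrite DP DQ lt0r_neq0.
Qed.

Lemma root_polyBP {z : R} : 0 < z ->
  root B z <-> height_eq ax ay az PG z = 1.
Proof.
move=> z0; rewrite rootE polyB_height_eq //.
have D0 : az ^+ 2 * (P * z + c) ^+ 2 * (Q * z + c) ^+ 2 != 0.
  by rewrite lt0r_neq0 // !mulr_gt0 ?den_gt0.
rewrite mulf_eq0 (negPf D0) subr_eq0 /=.
by split=> /eqP.
Qed.

(** [B] is negative at [0]; at [az], the factor [z^2 - az^2] of its only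
    possibly negative term vanishes. *)
Lemma polyB_pos_root : exists2 z, 0 < z & root B z.
Proof.
have B0 : B.[0] < 0.
  have -> : B.[0] = - (az ^+ 2 * c ^+ 4) by rewrite horner_polyB; ring.
  by rewrite oppr_lt0 mulr_gt0 // exprn_gt0.
have Baz : 0 <= B.[az].
  rewrite horner_polyB subrr !mul0r addr0.
  have sq4_ge0 (a b d e : R) : 0 <= a ^+ 2 * b ^+ 2 * d ^+ 2 * e ^+ 2.
    by rewrite -!exprMn sqr_ge0.
  by apply: mulr_ge0; [exact: sqr_ge0 | exact: addr_ge0].
have [z /andP[z_ge0 _] rz] : exists2 z, 0 <= z <= az & root B z.
  by apply: poly_ivt; rewrite ?(ltW az_gt0) // (ltW B0).
exists z => //; rewrite lt_def z_ge0 andbT.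
by apply: contraTneq rz => ->; rewrite rootE lt_eqF.
Qed.

(** * Footpoints and their heights *)

(** A footpoint cannot have height zero, since the third coordinate of the line
    equation would then give [ZG = 0].  Conversely, the point given by the
    formulas lies in the first octant because [XG] and [YG] are nonnegative and
    the denominators are positive. *)
Lemma footpointP (PE : 'rV[R]_3) :
  is_footpoint ax ay az PG PE <->
  [/\ 0 < zcoord PE, height_eq ax ay az PG (zcoord PE) = 1,
      xcoord PE = ax ^+ 2 * xcoord PG * zcoord PE / (P * zcoord PE + c)
    & ycoord PE = ay ^+ 2 * ycoord PG * zcoord PE / (Q * zcoord PE + c)].
Proof.
have onE : 0 < zcoord PE ->
    xcoord PE = ax ^+ 2 * xcoord PG * zcoord PE / (P * zcoord PE + c) ->
    ycoord PE = ay ^+ 2 * ycoord PG * zcoord PE / (Q * zcoord PE + c) ->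
    height_eq ax ay az PG (zcoord PE) =
    xcoord PE ^+ 2 / ax ^+ 2 + ycoord PE ^+ 2 / ay ^+ 2
      + zcoord PE ^+ 2 / az ^+ 2.
  move=> z0 -> ->; rewrite /height_eq -/c -/P -/Q.
  have DP : P * zcoord PE + c != 0 by rewrite lt0r_neq0 // den_gt0.
  have DQ : Q * zcoord PE + c != 0 by rewrite lt0r_neq0 // den_gt0.
  move: c P Q DP DQ => c' P' Q' DP DQ.
  by field; rewrite DP DQ !lt0r_neq0.
split.
  case=> [onPE [_ _ z_ge0] [t /normal_line_coords[ex ey ez]]].
  have z0 : 0 < zcoord PE.
    rewrite lt_def z_ge0 andbT; apply/eqP => z_eq0.
    by move: ez ZG_gt0; rewrite z_eq0 mul0r mulr0 subr0 => ->; rewrite ltxx.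
  have hx := (normal_line_coordP az_gt0 az_lt_ax ZG_gt0 z0 ez).1 ex.
  have hy := (normal_line_coordP az_gt0 az_lt_ay ZG_gt0 z0 ez).1 ey.
  by split=> //; rewrite onE.
case=> z0 hz hx hy; split.
- by rewrite /on_ellipsoid -onE.
- have coord_ge0 (a x p : R) : 0 <= x -> 0 < p ->
      0 <= a ^+ 2 * x * zcoord PE / (p * zcoord PE + c).
    move=> x_ge0 p0; apply: divr_ge0; last exact/ltW/den_gt0.
    by apply: mulr_ge0; [exact: mulr_ge0 (sqr_ge0 a) x_ge0 | exact: ltW].
  by split; [rewrite hx coord_ge0 | rewrite hy coord_ge0 | exact: ltW].
- pose t := az ^+ 2 * (zcoord PG - zcoord PE) / zcoord PE.
  have ez : zcoord PG - zcoord PE = t * (zcoord PE / az ^+ 2).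
    by rewrite /t; field; rewrite !lt0r_neq0.
  exists t; apply/normal_line_coords; split=> //.
  + by apply/(normal_line_coordP az_gt0 az_lt_ax ZG_gt0 z0 ez).
  + by apply/(normal_line_coordP az_gt0 az_lt_ay ZG_gt0 z0 ez).
Qed.

End Height.

Theorem mainTheorem3 (R : realType) (ax ay az : R) (PG : 'rV[R]_3)
    (h_az_gt0 : 0 < az) (h_az_lt_ay : az < ay) (h_ay_lt_ax : ay < ax)
    (hXG : 0 <= xcoord PG) (hYG : 0 <= ycoord PG) (hZG : 0 < zcoord PG) :
  let P := ax ^+ 2 - az ^+ 2 in
  let Q := ay ^+ 2 - az ^+ 2 in
  let B := polyB ax ay az PG in
  (exists! z : R, 0 < z /\ root B z) /\
  (exists! PE : 'rV[R]_3, is_footpoint ax ay az PG PE) /\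
  (forall PE : 'rV[R]_3, is_footpoint ax ay az PG PE ->
     [/\ 0 < zcoord PE,
         root B (zcoord PE),
         xcoord PE = ax ^+ 2 * xcoord PG * zcoord PE
                       / (P * zcoord PE + az ^+ 2 * zcoord PG)
       & ycoord PE = ay ^+ 2 * ycoord PG * zcoord PE
                       / (Q * zcoord PE + az ^+ 2 * zcoord PG)]).
Proof.
move=> P Q B.
have rootP (z : R) : 0 < z -> root B z <-> height_eq ax ay az PG z = 1.
  exact: root_polyBP.
have footP (PE : 'rV[R]_3) := footpointP h_az_gt0 h_az_lt_ay
  h_ay_lt_ax hXG hYG hZG PE.
have inj (y z : R) := @height_eq_inj _ _ _ _ PG h_az_gt0 h_az_lt_ay h_ay_lt_ax
  hZG y z.
have [z z0 rz] : exists2 z, 0 < z & root B z by apply: polyB_pos_root.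
have hz := (rootP z z0).1 rz.
split; [|split].
- exists z; split=> // w [w0 rw].
  by apply: inj => //; rewrite hz ((rootP w w0).1 rw).
- pose x := ax ^+ 2 * xcoord PG * z / (P * z + az ^+ 2 * zcoord PG).
  pose y := ay ^+ 2 * ycoord PG * z / (Q * z + az ^+ 2 * zcoord PG).
  have [rx ry rz3] := row3_coords x y z.
  exists (row3 x y z); split; first by apply/footP; rewrite rx ry rz3.
  move=> PE /footP[w0 hw ex ey].
  have ezw : z = zcoord PE by apply: inj => //; rewrite hz hw.
  by apply: coords_inj; rewrite ?rx ?ry ?rz3 ?ex ?ey -?ezw.
- by move=> PE /footP[w0 hw ex ey]; split=> //; apply/rootP.
Qed.
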